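(* Let $(\mathcal{A},\cdot,[\cdot,\cdot],\alpha)$ be a Hom-Poisson superalgebra. Let $D$ be an even derivation of $(\mathcal{A},\cdot)$ such that $D\alpha=\alpha D$ and $$D([x,y])=[D(x),y]+[x,D(y)]+\lambda[x,y],\qquad\forall\, x,y\in\mathcal{A},$$ where $\lambda$ is a fixed complex number. Define $$x\circ y=x\cdot D(y)+\lambda\, x\cdot y,\qquad\forall\, x,y\in\mathcal{A}.$$ Then $(\mathcal{A},[\cdot,\cdot],\circ,\alpha)$ is a super Hom-Gel'fand-Dorfman bialgebra.
   Context: All linear spaces are over $\mathbb{C}$. A superspace is a $\mathbb{Z}_2$-graded linear space $\mathcal{A}=\mathcal{A}_0\oplus\mathcal{A}_1$; $|x|\in\{0,1\}$ is the parity of a homogeneous element $x$. Formulas containing $|x|$ are stated for homogeneous elements and extended by linearity. Hom-associative superalgebra $(\mathcal{A},\cdot,\alpha)$: a superspace with an even bilinear product $\cdot$ and an even linear map $\alpha:\mathcal{A}\to\mathcal{A}$ such that $\alpha(x)\cdot(y\cdot z)=(x\cdot y)\cdot\alpha(z)$ for all $x,y,z$. It is commutative if $x\cdot y=(-1)^{|x||y|}y\cdot x$ for all homogeneous $x,y$. An even derivation of $(\mathcal{A},\cdot)$ is an even linear map $D:\mathcal{A}\to\mathcal{A}$ with $D(x\cdot y)=D(x)\cdot y+x\cdot D(y)$. Hom-Lie superalgebra $(\mathcal{A},[\cdot,\cdot],\alpha)$: a superspace with an even bilinear map $[\cdot,\cdot]:\mathcal{A}\times\mathcal{A}\to\mathcal{A}$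 and an even linear map $\alpha:\mathcal{A}\to\mathcal{A}$ such that for all homogeneous $x,y,z$: $[x,y]=-(-1)^{|x||y|}[y,x]$ and $(-1)^{|x||z|}[[x,y],\alpha(z)]+(-1)^{|x||y|}[[y,z],\alpha(x)]+(-1)^{|y||z|}[[z,x],\alpha(y)]=0$. Hom-Poisson superalgebra $(\mathcal{A},\cdot,[\cdot,\cdot],\alpha)$: a superspace with two operations and a linear selfmap $\alpha$ such that $(\mathcal{A},\cdot,\alpha)$ is a commutative Hom-associative superalgebra, $(\mathcal{A},[\cdot,\cdot],\alpha)$ is a Hom-Lie superalgebra, and for all homogeneous $x,y,z$: $[\alpha(x),y\cdot z]=(-1)^{|x||y|}\alpha(y)\cdot[x,z]+(-1)^{|z|(|x|+|y|)}\alpha(z)\cdot[x,y]$. Hom-Novikov superalgebra $(\mathcal{A},\circ,\alpha)$: a superspace with an even bilinear operation $\circ$ and an even linear map $\alpha$ such that for all homogeneous $x,y,z$: $(x\circ y)\circ\alpha(z)-\alpha(x)\circ(y\circ z)=(-1)^{|x||y|}\big((y\circ x)\circ\alpha(z)-\alpha(y)\circ(x\circ z)\big)$ and $(x\circ y)\circ\alpha(z)=(-1)^{|y||z|}(x\circ z)\circ\alpha(y)$. Super Hom-Gel'fand-Dorfman bialgebra $(\mathcal{A},[\cdot,\cdot],\circ,\alpha)$: a superspace with an even linear map $\alpha$ and two operations such that $(\mathcal{A},[\cdot,\cdot],\alpha)$ is a Hom-Lie superalgebra, $(\mathcal{A},\circ,\alpha)$ is a Hom-Novikov superalgebra, and for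 all homogeneous $x,y,z$: $[x\circ y,\alpha(z)]-(-1)^{|y||z|}[x\circ z,\alpha(y)]+[x,y]\circ\alpha(z)-(-1)^{|y||z|}[x,z]\circ\alpha(y)-\alpha(x)\circ[y,z]=0$. *)

(* Defs.v *)
From mathcomp Require Import all_boot all_order all_algebra.
From mathcomp Require Import reals complex.

Set Implicit Arguments.
Unset Strict Implicit.
Unset Printing Implicit Defensive.

Import GRing.Theory.
Local Open Scope ring_scope.

(* The grading group Z/2 is [bool] with [addb]: [homog A false] is the even part
   A_0 and [homog A true] the odd part A_1. The carrier has no dimension
   restriction. *)
Record superspace (K : fieldType) := Superspace {
  carrier :> lmodType K;
  homog : bool -> {pred carrier};
  homog_submod : forall i, GRing.submod_closed (homog i);
  homog_span : forall x, exists2 x0, x0 \in homog false &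
                         exists2 x1, x1 \in homog true & x = x0 + x1;
  homog_disjoint : forall x, x \in homog false -> x \in homog true -> x = 0
}.
Arguments homog {K} A i : rename.

(* In the records below the parities of homogeneous x, y, z are called i, j, k
   and are read as natural numbers in exponents of -1. As 0 belongs to both
   parts, it is used with either parity; this is harmless, since every identity
   is multilinear. *)
Section SuperAlgebras.
Variables (K : fieldType) (A : superspace K).

Definition even_linear (f : A -> A) : Prop :=
  linear f /\ forall i x, x \in homog A i -> f x \in homog A i.

Definition even_bilinear (f : A -> A -> A) : Prop :=
  bilinear_for *:%R *:%R f /\
  forall i j x y, x \in homog A i -> y \in homog A j ->
    f x y \in homog A (i (+) j).

Variables mul bracket circ : A -> A -> A.
Variable alpha : A -> A.
Local Notation "x ∙ y" := (mul x y) (at level 40, left associativity).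
Local Notation "x ∘ y" := (circ x y) (at level 40, left associativity).
Local Notation "⟦ x , y ⟧" := (bracket x y) (at level 0).

Record hom_associative_superalgebra : Prop := {
  hom_assoc_mul_even : even_bilinear mul;
  hom_assoc_alpha_even : even_linear alpha;
  hom_assoc_eq : forall x y z, alpha x ∙ (y ∙ z) = (x ∙ y) ∙ alpha z
}.

Definition supercommutative : Prop :=
  forall i j x y, x \in homog A i -> y \in homog A j ->
    x ∙ y = (-1) ^+ (i * j) *: (y ∙ x).

Record even_derivation (D : A -> A) : Prop := {
  even_derivation_even : even_linear D;
  even_derivation_eq : forall x y, D (x ∙ y) = D x ∙ y + x ∙ D y
}.

Record hom_Lie_superalgebra : Prop := {
  hom_Lie_bracket_even : even_bilinear bracket;
  hom_Lie_alpha_even : even_linear alpha;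
  hom_Lie_skew : forall i j x y, x \in homog A i -> y \in homog A j ->
    ⟦x, y⟧ = - ((-1) ^+ (i * j) *: ⟦y, x⟧);
  hom_Lie_jacobi : forall i j k x y z,
    x \in homog A i -> y \in homog A j -> z \in homog A k ->
    (-1) ^+ (i * k) *: ⟦⟦x, y⟧, alpha z⟧
    + (-1) ^+ (i * j) *: ⟦⟦y, z⟧, alpha x⟧
    + (-1) ^+ (j * k) *: ⟦⟦z, x⟧, alpha y⟧ = 0
}.

Record hom_Poisson_superalgebra : Prop := {
  hom_Poisson_assoc : hom_associative_superalgebra;
  hom_Poisson_comm : supercommutative;
  hom_Poisson_Lie : hom_Lie_superalgebra;
  hom_Poisson_leibniz : forall i j k x y z,
    x \in homog A i -> y \in homog A j -> z \in homog A k ->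
    ⟦alpha x, y ∙ z⟧ =
      (-1) ^+ (i * j) *: (alpha y ∙ ⟦x, z⟧)
      + (-1) ^+ (k * (i + j)) *: (alpha z ∙ ⟦x, y⟧)
}.

Record hom_Novikov_superalgebra : Prop := {
  hom_Novikov_circ_even : even_bilinear circ;
  hom_Novikov_alpha_even : even_linear alpha;
  hom_Novikov_left_sym : forall i j k x y z,
    x \in homog A i -> y \in homog A j -> z \in homog A k ->
    (x ∘ y) ∘ alpha z - alpha x ∘ (y ∘ z) =
      (-1) ^+ (i * j) *: ((y ∘ x) ∘ alpha z - alpha y ∘ (x ∘ z));
  hom_Novikov_right_comm : forall i j k x y z,
    x \in homog A i -> y \in homog A j -> z \in homog A k ->
    (x ∘ y) ∘ alpha z = (-1) ^+ (j * k) *: ((x ∘ z) ∘ alpha y)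
}.

Record super_hom_Gelfand_Dorfman_bialgebra : Prop := {
  hom_GD_Lie : hom_Lie_superalgebra;
  hom_GD_Novikov : hom_Novikov_superalgebra;
  hom_GD_compat : forall i j k x y z,
    x \in homog A i -> y \in homog A j -> z \in homog A k ->
    ⟦x ∘ y, alpha z⟧ - (-1) ^+ (j * k) *: ⟦x ∘ z, alpha y⟧
    + ⟦x, y⟧ ∘ alpha z - (-1) ^+ (j * k) *: (⟦x, z⟧ ∘ alpha y)
    - alpha x ∘ ⟦y, z⟧ = 0
}.

End SuperAlgebras.

(* Main.v *)
Require Import Defs.
From mathcomp Require Import all_boot all_order all_algebra.
From mathcomp Require Import reals complex.

(** Put [E = D + lambda], so that [x ∘ y = x · E y]. Then [E] is a genuine
    derivation of the bracket (the [lambda]-twist is absorbed), while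
    [E (x · y) = D x · y + x · E y]. Right commutativity follows from
    [(x · E y) · α (E z) = α x · (E y · E z)]; the associator of [∘] equals
    [(x · y) · α (lambda E z - E (E z))], which is supersymmetric in [x, y];
    and the compatibility condition cancels term by term after expanding
    [[x · y, α z]] by the Leibniz rule in the left argument of the bracket. *)

Import GRing.Theory.
Local Open Scope ring_scope.

Section Superspaces.
Context {K : fieldType} {A : superspace K}.
Implicit Types (f D : A -> A) (m mul bracket : A -> A -> A) (x y z : A).

Lemma homogD i x y :
  x \in homog A i -> y \in homog A i -> x + y \in homog A i.
Proof.
by move=> xi yi; rewrite -[x]scale1r; case: (homog_submod A i) => _; apply.
Qed.

Lemma homogZ i a x : x \in homog A i -> a *: x \in homog A i.
Proof.
by move=> xi; case: (homog_submod A i) => h0 hS; rewrite -[_ *: _]addr0; apply: hS.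
Qed.

Lemma bilinearDl {m} : even_bilinear m ->
  forall x y z, m (x + y) z = m x z + m y z.
Proof. by move=> [[hl _] _] x y z; have := hl z 1 x y; rewrite /= !scale1r. Qed.

Lemma bilinearDr {m} : even_bilinear m ->
  forall x y z, m x (y + z) = m x y + m x z.
Proof. by move=> [[_ hr] _] x y z; have := hr x 1 y z; rewrite /= !scale1r. Qed.

Lemma bilinear0l {m} : even_bilinear m -> forall y, m 0 y = 0.
Proof. by move=> hm y; apply: (addrI (m 0 y)); rewrite -bilinearDl // !addr0. Qed.

Lemma bilinear0r {m} : even_bilinear m -> forall x, m x 0 = 0.
Proof. by move=> hm x; apply: (addrI (m x 0)); rewrite -bilinearDr // !addr0. Qed.

Lemma bilinearZl {m} : even_bilinear m ->
  forall a x y, m (a *: x) y = a *: m x y.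
Proof.
move=> hm a x y; have [[hl _] _] := hm.
by have := hl y a x 0; rewrite !addr0 /= bilinear0l // addr0.
Qed.

Lemma bilinearZr {m} : even_bilinear m ->
  forall a x y, m x (a *: y) = a *: m x y.
Proof.
move=> hm a x y; have [[_ hr] _] := hm.
by have := hr x a y 0; rewrite !addr0 /= bilinear0r // addr0.
Qed.

Lemma bilinearNr {m} : even_bilinear m -> forall x y, m x (- y) = - m x y.
Proof. by move=> hm x y; rewrite -scaleN1r bilinearZr // scaleN1r. Qed.

Lemma even_linear_shift D (a : K) :
  even_linear D -> even_linear (fun x => D x + a *: x).
Proof.
move=> [linD evD]; split=> [b x y|i x xi]; last by rewrite homogD ?evD ?homogZ.
by rewrite linD !scalerDr !scalerA [a * b]mulrC addrACA.
Qed.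

Lemma even_bilinear_comp_r {m f} :
  even_bilinear m -> even_linear f -> even_bilinear (fun x y => m x (f y)).
Proof.
move=> hm [linf evf]; split; first split=> [y a u v|x a u v] /=.
- by rewrite bilinearDl // bilinearZl.
- by rewrite linf bilinearDr // bilinearZr.
by move=> i j x y xi yj; apply: hm.2 => //; apply: evf.
Qed.

(** Skew-symmetry moves the product into the right slot, where the Leibniz axiom applies.
    Skew-symmetry then turns both inner brackets back, and supercommutativity swaps the factors of
    the second product. *)
Lemma hom_Poisson_leibniz_l {mul bracket alpha}
    (hP : hom_Poisson_superalgebra mul bracket alpha) i j k x y z :
    x \in homog A i -> y \in homog A j -> z \in homog A k ->
  bracket (mul x y) (alpha z) =
    mul (alpha x) (bracket y z)
    + (-1) ^+ (j * k) *: mul (bracket x z) (alpha y).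
Proof.
case: hP => -[hm [_ evalpha] _] comm [hb _ skew _] leib xi yj zk.
rewrite (skew (i (+) j) k) ?hm.2 ?evalpha // (leib k i j) //.
rewrite (skew k j z y) // (skew k i z x) // !(bilinearNr hm) !(bilinearZr hm).
rewrite (comm j (i (+) k) (alpha y)) ?evalpha ?hb.2 //.
(* Only the signs in front of two fixed products remain. Their exponents mix [i (+) j] with [i + j],
   which agree only modulo 2, hence the check of all eight parities. *)
clear; move: (mul _ _) (mul _ _) => u v.
rewrite !(scalerN, scalerDr, scalerA, opprD, opprK).
case: i; case: j; case: k; rewrite /= !(muln0, muln1, addn0, add0n) /=
  ?(expr0, expr1, sqrrN, expr1n, mulr1, mulrN1, opprK, scale1r, scaleN1r) //.
Qed.

End Superspaces.

Theorem theorem3p14 (R : realType) (A : superspace R[i])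
    (mul bracket : A -> A -> A) (alpha D : A -> A) (lambda : R[i])
    (hPoisson : hom_Poisson_superalgebra mul bracket alpha)
    (hD : even_derivation mul D)
    (hDalpha : forall x, D (alpha x) = alpha (D x))
    (hDbracket : forall x y, D (bracket x y) =
       bracket (D x) y + bracket x (D y) + lambda *: bracket x y) :
  super_hom_Gelfand_Dorfman_bialgebra bracket
    (fun x y => mul x (D y) + lambda *: mul x y) alpha.
Proof.
have [[hm halpha assoc] comm hLie _] := hPoisson.
have [hb _ skew _] := hLie.
have [linalpha evalpha] := halpha.
have [evD derD] := hD.
pose E x := D x + lambda *: x.
have hE : even_linear E by apply: even_linear_shift.
have circE x y : mul x (D y) + lambda *: mul x y = mul x (E y).
  by rewrite /E (bilinearDr hm) (bilinearZr hm).
have Ealpha x : E (alpha x) = alpha (E x).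
  by rewrite /E hDalpha addrC [in RHS]addrC linalpha.
have Emul x y : E (mul x y) = mul (D x) y + mul x (E y).
  by rewrite /E derD -addrA circE.
have Ebracket x y : E (bracket x y) = bracket (E x) y + bracket x (E y).
  (* Both sides contain [lambda *: bracket x y] twice: on the left once from the twist and once from
     the shift, on the right once from each slot. *)
  rewrite /E hDbracket (bilinearDl hb) (bilinearDr hb).
  rewrite (bilinearZl hb) (bilinearZr hb).
  by rewrite -!addrA; congr (_ + _); rewrite addrCA.
have circ_even : even_bilinear (fun x y => mul x (D y) + lambda *: mul x y).
  (* [circE] is a pointwise equality, so each clause is transported separately. *)
  have [[hl hr] hev] := even_bilinear_comp_r hm hE.
  split; first split.
  - by move=> y a u v; rewrite /= !circE; apply: hl.
  - by move=> x a u v; rewrite /= !circE; apply: hr.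
  by move=> i j x y xi yj; rewrite circE; apply: hev.
have associatorE x y z :
    mul (mul x (E y)) (E (alpha z)) - mul (alpha x) (E (mul y (E z)))
    = mul (mul x y) (alpha (lambda *: E z - E (E z))).
  (* Hom-associativity extracts [alpha x] on the left of every term. In what remains, [E y] minus
     [D y] is [lambda *: y], so the terms in [D y] cancel. *)
  rewrite Ealpha -!assoc -(bilinearNr hm) -(bilinearDr hm); congr (mul _ _).
  rewrite Emul {1}/E (bilinearDl hm) (bilinearZl hm) opprD addrA.
  rewrite (addrC (mul (D y) _)) addrK.
  by rewrite -(bilinearZr hm) -(bilinearNr hm) -(bilinearDr hm).
clearbody E.
split=> //; first split=> //.
- move=> i j k x y z xi yj zk; rewrite !circE !associatorE.
  by rewrite (comm i j x y) // (bilinearZl hm).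
- move=> i j k x y z xi yj zk; rewrite !circE !Ealpha -!assoc -(bilinearZr hm).
  by congr (mul _ _); apply: comm; apply: hE.2.
move=> i j k x y z xi yj zk; rewrite !circE !Ealpha Ebracket.
rewrite (hom_Poisson_leibniz_l hPoisson i j k) ?hE.2 //.
rewrite (hom_Poisson_leibniz_l hPoisson i k j) ?hE.2 //.
(* This matches the second summand of [E (bracket y z)]; the sign it creates squares away against
   the one already present. *)
rewrite (skew k j (E z) y) ?hE.2 //.
rewrite !(bilinearNr hm, bilinearZr hm) (bilinearDr hm).
rewrite mulnC scalerDr scalerN !scalerA -expr2 sqrr_sign !scale1r.
rewrite opprD opprK.
(* Four terms are left, each occurring once with either sign: [a] and [b] are the two halves of
   [mul (alpha x) (E (bracket y z))], while [c] and [d] come from [bracket x y] and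
   [bracket x z]. *)
move: (mul _ (bracket (E y) z)) (mul _ (bracket y (E z))) => a b.
move: (mul _ (alpha (E z))) (_ *: mul _ _) => c d.
by rewrite (addrA (a + d)) subrK (addrAC a) addrK subrr.
Qed.
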